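(* Let $d\in\mathbb{N}=\{0,1,2,\ldots\}$, $n\in\{1,2,\ldots\}$, $\boldsymbol{\alpha}=(\alpha_1,\ldots,\alpha_n)$ with $0<\alpha_1\le\cdots\le\alpha_n<+\infty$, and let $\mathbb{H}(d,\boldsymbol{\alpha})$ be the corank $1$ Carnot group with projections $\pi_1,\ldots,\pi_{d+2n+1}:\mathbb{H}(d,\boldsymbol{\alpha})\to\mathbb{R}^{d+2n}$. Then $$\int_{\mathbb{H}(d,\boldsymbol{\alpha})}\prod_{j=1}^{d+2n+1}f_j(\pi_j(x,t))\,dx\,dt\le\prod_{j=1}^{d+2n+1}\|f_j\|_{d+2n}$$ for all non-negative measurable functions $f_1,\ldots,f_{d+2n+1}$ on $\mathbb{R}^{d+2n}$.
   Context: The group $\mathbb{H}(d,\boldsymbol{\alpha})$ is $\mathbb{R}^{d+2n}\times\mathbb{R}\cong\mathbb{R}^{d+2n+1}$ (points $(x,t)$, $x\in\mathbb{R}^{d+2n}$, $t\in\mathbb{R}$) with group law $$(x,t)\cdot(x',t')=\Big(x+x',\,t+t'+\tfrac12\sum_{j=1}^n\alpha_j(x_{d+2j-1}x'_{d+2j}-x_{d+2j}x'_{d+2j-1})\Big),$$ and $dx\,dt$ is Lebesgue measure. For $x\in\mathbb{R}^{d+2n}$, $\hat x_j\in\mathbb{R}^{d+2n-1}$ is obtained from $x$ by deleting the $j$-th coordinate. The projections are - $\pi_j(x,t)=(\hat x_j,t)$ for $1\le j\le d$; - $\pi_{d+2j-1}(x,t)=\big(\hat x_{d+2j-1},\,t+\tfrac{\alpha_j}{2}x_{d+2j-1}x_{d+2j}\big)$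 for $1\le j\le n$; - $\pi_{d+2j}(x,t)=\big(\hat x_{d+2j},\,t-\tfrac{\alpha_j}{2}x_{d+2j-1}x_{d+2j}\big)$ for $1\le j\le n$; - $\pi_{d+2n+1}(x,t)=x$. $\|f\|_p$ is the $L^p$ norm (possibly $+\infty$) with respect to Lebesgue measure; $0\cdot\infty=0$. *)

(* Defs.v *)
From HB Require Import structures.
From mathcomp Require Import all_boot all_order all_algebra.
From mathcomp Require Import ring.
From mathcomp Require Import all_classical all_reals all_analysis.
From mathcomp Require Import measurable_realfun.

Set Implicit Arguments.
Unset Strict Implicit.
Unset Printing Implicit Defensive.
Import Order.TTheory GRing.Theory Num.Theory.
Import numFieldNormedType.Exports.

Local Open Scope classical_set_scope.
Local Open Scope ring_scope.

Section tuple_coord.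
Context {R : realType} {m : nat}.

Lemma nth_mktuple_lt (F : 'I_m -> R) (k : nat) (km : (k < m)%N) :
  [tuple F i | i < m]`_k = F (Ordinal km).
Proof. by rewrite -[k]/(val (Ordinal km)) nth_mktuple. Qed.

Lemma eq_from_coord (x y : m.-tuple R) :
  (forall i, (i < m)%N -> x`_i = y`_i) -> x = y.
Proof.
by move=> xy; apply: eq_from_tnth => i; rewrite !(tnth_nth 0) xy.
Qed.

End tuple_coord.

(* Borel-Lebesgue measure on R^m, R^m being [m.-tuple R] with its product     *)
(* sigma-algebra: R^0 is a point of mass 1 and R^(m+1) = R^m x R by appending *)
(* the last coordinate.                                                       *)
Section lebesgue_tuple.
Context {R : realType}.
Local Open Scope ereal_scope.
Local Notation T := (measurableTypeR R).

Definition tuple_rcons m (p : m.-tuple T * T) : m.+1.-tuple T :=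
  [tuple of rcons p.1 p.2].

Lemma tnth_tuple_rcons m (p : m.-tuple T * T) (i : 'I_m.+1) :
  tnth (tuple_rcons p) i = if (i < m)%N then nth 0%R p.1 i else p.2.
Proof.
rewrite (tnth_nth 0%R) /= nth_rcons size_tuple.
by case: ltngtP => // mi; have := ltn_ord i; rewrite ltnS leqNgt mi.
Qed.

Lemma measurable_tuple_rcons m : measurable_fun setT (@tuple_rcons m).
Proof.
apply/measurable_fun_tnthP => i; case: (ltnP i m) => im.
- rewrite (_ : _ \o _ = (fun x : m.-tuple T => tnth x (Ordinal im)) \o fst).
    by apply: measurableT_comp => //; exact: measurable_tnth.
  by apply/funext => p; rewrite /= tnth_tuple_rcons im (tnth_nth 0%R).
- rewrite (_ : _ \o _ = snd); first exact: measurable_snd.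
  by apply/funext => p; rewrite /= tnth_tuple_rcons ltnNge im.
Qed.

Definition tuple_unrcons m (x : m.+1.-tuple T) : m.-tuple T * T :=
  ([tuple tnth x (widen_ord (leqnSn m) i) | i < m], tnth x ord_max).

Lemma tuple_unrconsK m : cancel (@tuple_unrcons m) (@tuple_rcons m).
Proof.
move=> x; apply: eq_from_tnth => i; rewrite tnth_tuple_rcons /=.
case: ifPn => [im|]; first rewrite (@nth_mktuple_lt R _ _ _ im).
  by congr tnth; exact/val_inj.
rewrite -leqNgt => mi; congr tnth; apply/val_inj => /=.
by apply/eqP; rewrite eqn_leq mi -ltnS ltn_ord.
Qed.

Lemma tuple_rconsK m : cancel (@tuple_rcons m) (@tuple_unrcons m).
Proof.
move=> p; rewrite [RHS]surjective_pairing; congr pair.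
- apply: eq_from_tnth => i.
  by rewrite tnth_mktuple tnth_tuple_rcons /= ltn_ord (tnth_nth 0%R).
- by rewrite tnth_tuple_rcons /= ltnn.
Qed.

Lemma measurable_tuple_unrcons m : measurable_fun setT (@tuple_unrcons m).
Proof.
apply/measurable_fun_pairP; split => /=; last exact: measurable_tnth.
apply/measurable_fun_tnthP => i.
rewrite (_ : _ \o _ =
  (fun x : m.+1.-tuple T => tnth x (widen_ord (leqnSn m) i))).
  exact: measurable_tnth.
by apply/funext => x; rewrite /= tnth_mktuple.
Qed.

Section rcons_measure.
Variables (m : nat) (mu : {sigma_finite_measure set (m.-tuple T) -> \bar R}).

Definition rcons_measure : set (m.+1.-tuple T) -> \bar R :=
  pushforward (mu \x @lebesgue_measure R) (@tuple_rcons m).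

Let rcons_measure0 : rcons_measure set0 = 0.
Proof. by rewrite /rcons_measure /pushforward preimage_set0 measure0. Qed.

Let rcons_measure_ge0 A : 0 <= rcons_measure A.
Proof. exact: integral_ge0. Qed.

Let rcons_measure_sigma_additive : semi_sigma_additive rcons_measure.
Proof.
exact: (@measure_semi_sigma_additive _ _ _
  (measure_function_pushforward__canonical__measure_function_Measure
    (mu \x @lebesgue_measure R) (@measurable_tuple_rcons m))).
Qed.

HB.instance Definition _ := isMeasure.Build _ _ _ rcons_measure
  rcons_measure0 rcons_measure_ge0 rcons_measure_sigma_additive.

Let rcons_measure_sigma_finite : sigma_finite setT rcons_measure.
Proof.
have /sigma_finiteP[F [TF ndF Foo]] := sigma_finiteT mu.
have /sigma_finiteP[G [TG ndG Goo]] := sigma_finiteT (@lebesgue_measure R).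
exists (fun k => @tuple_unrcons m @^-1` (F k `*` G k)).
  rewrite -preimage_bigcup (_ : \bigcup_k _ = setT) ?preimage_setT//.
  apply/seteqP; split => // -[x t] _.
  have [i _ Fx] : (\bigcup_k F k) x by rewrite -TF.
  have [j _ Gt] : (\bigcup_k G k) t by rewrite -TG.
  exists (maxn i j) => //; split => /=.
  - by move: x Fx; exact/subsetPset/ndF/leq_maxl.
  - by move: t Gt; exact/subsetPset/ndG/leq_maxr.
move=> k; have [mF Fk] := Foo k; have [mG Gk] := Goo k.
split.
  rewrite -[X in measurable X]setTI; apply: measurable_tuple_unrcons => //.
  exact: measurableX.
rewrite /rcons_measure /pushforward -comp_preimage.
rewrite (_ : _ \o _ = id); last by apply/funext => p; exact: tuple_rconsK.
by rewrite [ltLHS]product_measure1E// lte_mul_pinfty// ge0_fin_numE.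
Qed.

HB.instance Definition _ := Measure_isSigmaFinite.Build _ _ _ rcons_measure
  rcons_measure_sigma_finite.

End rcons_measure.

Fixpoint lebesgue_tuple_rec m : {sigma_finite_measure set (m.-tuple T) -> \bar R} :=
  match m with
  | 0 => \d_([tuple] : 0.-tuple T)
  | m'.+1 => rcons_measure (lebesgue_tuple_rec m')
  end.

Definition lebesgue_tuple m : set (m.-tuple T) -> \bar R := lebesgue_tuple_rec m.

HB.instance Definition _ m := SigmaFiniteMeasure.on (@lebesgue_tuple m).

Lemma lebesgue_tuple_box m (A : 'I_m -> set T) :
  (forall i, measurable (A i)) ->
  lebesgue_tuple [set x : m.-tuple T | forall i, A i (tnth x i)] =
  \prod_(i < m) lebesgue_measure (A i).
Proof.
elim: m A => [|m IH] A mA.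
  rewrite big_ord0 /lebesgue_tuple /= diracE mem_set// => -[]//.
rewrite big_ord_recr /= -(IH (fun i => A (widen_ord (leqnSn m) i)))//.
rewrite -product_measure1E//; last first.
  rewrite (_ : mkset _ = \big[setI/setT]_(i < m)
      ((fun x : m.-tuple T => tnth x i) @^-1` A (widen_ord (leqnSn m) i))).
    apply: bigsetI_measurable => i _.
    by rewrite -[X in measurable X]setTI; exact: measurable_tnth.
  apply/seteqP; split => x /=.
    by move=> Ax; rewrite -bigcap_seq => i _; exact: Ax.
  by rewrite -bigcap_seq => Ax i; apply: Ax => /=; rewrite mem_index_enum.
rewrite /lebesgue_tuple /= /rcons_measure /pushforward; congr (_ \x _).
apply/seteqP; split => -[x t] /=.
  move=> Ax; split => [i|] /=.
    have := Ax (widen_ord (leqnSn m) i).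
    by rewrite tnth_tuple_rcons/= ltn_ord -tnth_nth.
  by have := Ax ord_max; rewrite tnth_tuple_rcons/= ltnn.
move=> [Ax At] i; rewrite tnth_tuple_rcons /=; case: ifPn => im.
  have := Ax (Ordinal im); rewrite (tnth_nth 0%R).
  by congr (A _ _); exact/val_inj.
rewrite (_ : i = ord_max)//; apply/val_inj/eqP.
by rewrite eqn_leq /= -ltnS ltn_ord leqNgt.
Qed.

End lebesgue_tuple.

(* R^m with Lebesgue measure on the sigma-algebra of all Lebesgue measurable  *)
(* sets, i.e. the completion of the Borel-Lebesgue measure.                   *)
Definition euclidean (R : realType) (m : nat) : Type :=
  caratheodory_type ((@lebesgue_tuple R m)^*)%mu.

HB.instance Definition _ (R : realType) m := Measurable.on (euclidean R m).

Definition Lebesgue {R : realType} {m : nat} : set (euclidean R m) -> \bar R :=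
  @completed_measure_extension _ _ _ (@lebesgue_tuple R m).

HB.instance Definition _ (R : realType) m := Measure.on (@Lebesgue R m).

Lemma LebesgueE (R : realType) m (A : set (m.-tuple (measurableTypeR R))) :
  measurable A -> Lebesgue (A : set (euclidean R m)) = lebesgue_tuple A.
Proof. exact: measurable_mu_extE. Qed.

(* The carrier R^(d+2n) x R of the corank 1 Carnot group H(d, alpha), with    *)
(* its sigma-algebra of Lebesgue measurable sets. Coordinates of x and        *)
(* components of alpha are numbered from 0: for 0 <= j < n, alpha`_j weights  *)
(* the pair of coordinates d + 2j, d + 2j + 1.                                *)
Definition carnot (R : realType) (d n : nat) (alpha : n.-tuple R) : Type :=
  caratheodory_type
    ((@lebesgue_tuple R (d + 2 * n) \x @lebesgue_measure R)%E^*)%mu.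
Arguments carnot {R} d {n} alpha.

HB.instance Definition _ (R : realType) d n (alpha : n.-tuple R) :=
  Measurable.on (carnot d alpha).

Definition carnot_Lebesgue (R : realType) (d n : nat) (alpha : n.-tuple R) :
    set (carnot d alpha) -> \bar R :=
  @completed_measure_extension _ _ _
    (@lebesgue_tuple R (d + 2 * n) \x @lebesgue_measure R)%E.
Arguments carnot_Lebesgue {R} d {n} alpha.

HB.instance Definition _ (R : realType) d n (alpha : n.-tuple R) :=
  Measure.on (carnot_Lebesgue d alpha).

Lemma carnot_LebesgueE (R : realType) d n (alpha : n.-tuple R)
    (A : set ((d + 2 * n).-tuple (measurableTypeR R) * measurableTypeR R)) :
  measurable A ->
  carnot_Lebesgue d alpha A =
  (@lebesgue_tuple R (d + 2 * n) \x @lebesgue_measure R)%E A.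
Proof. exact: measurable_mu_extE. Qed.

Section carnot.
Context {R : realType} {d n : nat} (alpha : n.-tuple R).
Local Notation m := (d + 2 * n)%N.
Local Notation H := (carnot d alpha).

Definition carnot_form (x y : m.-tuple R) : R :=
  \sum_(j < n) alpha`_j *
    (x`_(d + 2 * j) * y`_(d + 2 * j + 1) - x`_(d + 2 * j + 1) * y`_(d + 2 * j)).

Definition tuple_add (x y : m.-tuple R) : m.-tuple R :=
  [tuple x`_i + y`_i | i < m].

Definition carnot_mul (p q : H) : H :=
  (tuple_add p.1 q.1, p.2 + q.2 + 2^-1 * carnot_form p.1 q.1).

Definition carnot_one : H := ([tuple 0 | i < m], 0).

Definition carnot_inv (p : H) : H := ([tuple - p.1`_i | i < m], - p.2).

Let nth_add (x y : m.-tuple R) k : (k < m)%N ->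
  (tuple_add x y)`_k = x`_k + y`_k.
Proof. by move=> km; rewrite nth_mktuple_lt. Qed.

Let nth_opp (x : m.-tuple R) k : (k < m)%N -> [tuple - x`_i | i < m]`_k = - x`_k.
Proof. by move=> km; rewrite nth_mktuple_lt. Qed.

Let nth_zero k : (k < m)%N -> [tuple (0 : R) | i < m]`_k = 0.
Proof. by move=> km; rewrite nth_mktuple_lt. Qed.

Let idx0 (j : 'I_n) : (d + 2 * j < m)%N.
Proof. by rewrite ltn_add2l ltn_pmul2l. Qed.

Let idx1 (j : 'I_n) : (d + 2 * j + 1 < m)%N.
Proof.
rewrite -addnA ltn_add2l (@leq_trans (2 * j.+1))%N ?leq_pmul2l//.
by rewrite mulnS addnC ltn_add2r.
Qed.

Let formDl x y z : carnot_form (tuple_add x y) z =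
  carnot_form x z + carnot_form y z.
Proof.
rewrite -big_split; apply: eq_bigr => j _ /=.
by rewrite !nth_add ?idx0 ?idx1//; ring.
Qed.

Let formDr x y z : carnot_form x (tuple_add y z) =
  carnot_form x y + carnot_form x z.
Proof.
rewrite -big_split; apply: eq_bigr => j _ /=.
by rewrite !nth_add ?idx0 ?idx1//; ring.
Qed.

Let formNl (x : m.-tuple R) : carnot_form [tuple - x`_i | i < m] x = 0.
Proof.
by apply: big1 => j _; rewrite !nth_opp ?idx0 ?idx1//; ring.
Qed.

Let formNr (x : m.-tuple R) : carnot_form x [tuple - x`_i | i < m] = 0.
Proof.
by apply: big1 => j _; rewrite !nth_opp ?idx0 ?idx1//; ring.
Qed.

Let form0l (x : m.-tuple R) : carnot_form [tuple 0 | i < m] x = 0.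
Proof.
by apply: big1 => j _; rewrite !nth_zero ?idx0 ?idx1//; ring.
Qed.

Let form0r (x : m.-tuple R) : carnot_form x [tuple 0 | i < m] = 0.
Proof.
by apply: big1 => j _; rewrite !nth_zero ?idx0 ?idx1//; ring.
Qed.

Let carnot_mulA : associative carnot_mul.
Proof.
move=> [x r] [y s] [z t]; congr pair => /=.
  by apply: eq_from_coord => i im; rewrite !nth_add// addrA.
by rewrite formDl formDr; ring.
Qed.

Let carnot_mul1g : left_id carnot_one carnot_mul.
Proof.
move=> [x r]; congr pair => /=; last by rewrite form0l; ring.
by apply: eq_from_coord => i im; rewrite nth_add// nth_zero// add0r.
Qed.

Let carnot_mulg1 : right_id carnot_one carnot_mul.
Proof.
move=> [x r]; congr pair => /=; last by rewrite form0r; ring.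
by apply: eq_from_coord => i im; rewrite nth_add// nth_zero// addr0.
Qed.

Let carnot_mulVg : left_inverse carnot_one carnot_inv carnot_mul.
Proof.
move=> [x r]; congr pair => /=; last by rewrite formNl; ring.
by apply: eq_from_coord => i im; rewrite nth_add// nth_zero// nth_opp// addNr.
Qed.

Let carnot_mulgV : right_inverse carnot_one carnot_inv carnot_mul.
Proof.
move=> [x r]; congr pair => /=; last by rewrite formNr; ring.
by apply: eq_from_coord => i im; rewrite nth_add// nth_zero// nth_opp// addrN.
Qed.

HB.instance Definition _ := isGroup.Build H
  carnot_mulA carnot_mul1g carnot_mulg1 carnot_mulVg carnot_mulgV.

(* x with its k-th coordinate deleted and s appended. *)
Definition tuple_replace (k : nat) (x : m.-tuple R) (s : R) : m.-tuple R :=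
  [tuple (rcons x s)`_(bump k i) | i < m].

(* Indices are shifted by one: carnot_proj k is the projection pi_(k+1), so   *)
(* that it deletes coordinate k of x for k < d + 2n.                          *)
Definition carnot_proj (k : 'I_m.+1) (p : H) : m.-tuple R :=
  let: (x, t) := p in
  if (k < d)%N then tuple_replace k x t
  else if (k < m)%N then
    let j := ((k - d) %/ 2)%N in
    let s := alpha`_j / 2 * x`_(d + 2 * j) * x`_(d + 2 * j + 1) in
    if odd (k - d) then tuple_replace k x (t - s) else tuple_replace k x (t + s)
  else x.

Let delta (k : nat) (a : R) : m.-tuple R :=
  [tuple if i == k :> nat then a else 0 | i < m].

Let nth_delta k a i : (i < m)%N -> (delta k a)`_i = if i == k then a else 0.
Proof. by move=> im; rewrite nth_mktuple_lt. Qed.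

Let form_delta_lt (x : m.-tuple R) (k : nat) (a : R) : (k < d)%N ->
  carnot_form x (delta k a) = 0.
Proof.
move=> kd; apply: big1 => j _; rewrite !nth_delta ?idx0 ?idx1//.
rewrite !gtn_eqF//; first by ring.
- exact/ltn_addr.
- by rewrite -addnA; exact/ltn_addr.
Qed.

Let form_delta0 (x : m.-tuple R) (i : 'I_n) (a : R) :
  carnot_form x (delta (d + 2 * i) a) = - (alpha`_i * x`_(d + 2 * i + 1) * a).
Proof.
rewrite /carnot_form (bigD1 i)//= big1 ?addr0.
  rewrite !nth_delta ?idx0 ?idx1// eqxx addn1 gtn_eqF//; ring.
move=> j ji; rewrite !nth_delta ?idx0 ?idx1//.
rewrite -addnA !eqn_add2l eqn_pmul2l// (negbTE (_ : val j != i))//.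
rewrite (_ : (2 * j + 1 == 2 * i)%N = false); first by ring.
by apply/negbTE/eqP => /(congr1 odd); rewrite addn1 /= !mul2n !odd_double.
Qed.

Let form_delta1 (x : m.-tuple R) (i : 'I_n) (a : R) :
  carnot_form x (delta (d + 2 * i + 1) a) = alpha`_i * x`_(d + 2 * i) * a.
Proof.
rewrite /carnot_form (bigD1 i)//= big1 ?addr0.
  rewrite !nth_delta ?idx0 ?idx1// eqxx addn1 ltn_eqF//; ring.
move=> j ji; rewrite !nth_delta ?idx0 ?idx1//.
rewrite eqn_add2r !eqn_add2l eqn_pmul2l// (negbTE (_ : val j != i))//.
rewrite (_ : (d + 2 * j == d + 2 * i + 1)%N = false); first by ring.
apply/negbTE; rewrite -addnA eqn_add2l.
by apply/eqP => /(congr1 odd); rewrite addn1 /= !mul2n !odd_double.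
Qed.

(* pi_k(p) is read off the point of the coset p * (R e_k) whose k-th          *)
(* coordinate vanishes.                                                       *)
Lemma carnot_proj_mul (k : 'I_m) (p : H) :
  let e : H := ([tuple if i == k :> nat then - p.1`_k else 0 | i < m], 0) in
  let q := (p * e)%g in
  carnot_proj (widen_ord (leqnSn m) k) p = tuple_replace k q.1 q.2.
Proof.
case: p => x t e q.
have replE s : tuple_replace k x s = tuple_replace k q.1 s.
  apply: eq_from_tnth => i; rewrite !tnth_mktuple !nth_rcons !size_tuple.
  case: ifPn => // bm; rewrite [RHS]nth_add// nth_delta//.
  by rewrite (negbTE (_ : bump k i != k)) ?addr0// eq_sym neq_bump.
have q2 : q.2 = t + 2^-1 * carnot_form x (delta k (- x`_k)).
  by rewrite /q /e /= addr0.
rewrite -replE q2 /carnot_proj /= ltn_ord.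
case: ifPn => [kd|]; first by rewrite form_delta_lt// mulr0 addr0.
rewrite -leqNgt => dk.
have jn : ((k - d) %/ 2 < n)%N by rewrite ltn_divLR// ltn_subLR// [(n * 2)%N]mulnC.
have kE := divn_eq (k - d) 2; rewrite modn2 [(_ %/ _ * 2)%N]mulnC in kE.
pose i := Ordinal jn.
case: ifPn => od; rewrite ?(negbTE od) ?od /= in kE; congr tuple_replace.
- have {}kE : k = (d + 2 * i + 1)%N :> nat by rewrite -addnA -kE subnKC.
  by rewrite [X in delta X]kE [in x`_k]kE form_delta1 /=; ring.
- have {}kE : k = (d + 2 * i)%N :> nat by rewrite -[(2 * i)%N]addn0 -kE subnKC.
  by rewrite [X in delta X]kE [in x`_k]kE form_delta0 /=; ring.
Qed.

End carnot.

(* Main.v *)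
Require Import Defs.
From mathcomp Require Import all_boot all_order all_algebra.
From mathcomp Require Import all_classical all_reals all_analysis.
From mathcomp Require Import measurable_realfun.

Set Implicit Arguments.
Unset Strict Implicit.
Unset Printing Implicit Defensive.
Import Order.TTheory GRing.Theory Num.Theory.
Import numFieldNormedType.Exports.
Local Open Scope classical_set_scope.
Local Open Scope ring_scope.
Local Open Scope ereal_scope.

(** Integrating in the variable t first reduces the inequality to the
    classical Loomis-Whitney inequality. Write m = d + 2n. For fixed x, each of
    the m projections pi_k other than the last has the form
    (x, t) |-> (x without its k-th coordinate, t + s_k(x)), so that, as a
    function of t, f_k o pi_k is a translate of t |-> f_k(x without x_k, t).
    Translations preserve Lebesgue measure, so Hoelder's inequality with m equal
    exponents bounds the integral in t by the product of the m numbers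
    F_k(x without x_k), where F_k(y) is the L^m norm of f_k(y, .). The shears
    s_k have disappeared, and with them the group structure. Hoelder's
    inequality in x, with exponents m for the last function and m / (m - 1) for
    the product of the F_k, and the Loomis-Whitney inequality on R^m, applied to
    the functions F_k^(m / (m - 1)), then give the claim, as the L^m norm of F_k
    is that of f_k by Tonelli.

    The Loomis-Whitney inequality on R^m needed here is itself the case s = 0
    of the same statement one dimension lower. Hence
    [sheared_loomis_whitney_succ] is a single induction on m, for arbitrary
    measurable shears; it rests on [le_integrate_last] (the integration in t)
    and [ge0_hoelder_step] (the splitting in x). To avoid norms, everything is
    stated for h_k = f_k^m, that is, as
    int prod h_k(pi_k)^(1/m) <= prod (int h_k)^(1/m).

    The induction uses Tonelli's theorem for product sigma-algebras, while the
    f_k are only Lebesgue measurable. By [measurable_majorant], f_k^m lies below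
    a Borel function with an integral that is not larger; replacing f_k^m by it
    can only increase the left-hand side and does not increase the right-hand
    one. *)

(** * Hoelder's inequality for finite families *)

Section ereal_products.
Context {R : realType}.

Lemma poweR_young (a b : R) (x y : \bar R) : (0 < a)%R -> (0 < b)%R ->
  (a + b = 1)%R -> 0 <= x -> 0 <= y ->
  x `^ a * y `^ b <= a%:E * x + b%:E * y.
Proof.
move=> a0 b0 ab; case: x => [x| |]//; case: y => [y| |]//; rewrite ?lee_fin.
- move=> x0 y0.
  have := @conjugate_powR R (powR x a) (powR y b) a^-1%R b^-1%R.
  rewrite -!powRrM !mulfV ?gt_eqF// !powRr1// !invrK.
  rewrite ![(_ * a)%R]mulrC ![(_ * b)%R]mulrC.
  by apply; rewrite ?powR_ge0 ?invr_gt0.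
- by move=> x0 _; rewrite (gt0_muley (_ : 0 < b%:E))// addey ?leey.
- by move=> _ y0; rewrite (gt0_muley (_ : 0 < a%:E))// addye ?leey.
- by move=> _ _; rewrite !gt0_muley// leey.
Qed.

Lemma poweR_prod (I : Type) (s : seq I) (F : I -> \bar R) (r : R) :
  (forall i, 0 <= F i) -> (\prod_(i <- s) F i) `^ r = \prod_(i <- s) F i `^ r.
Proof.
move=> F0; elim: s => [|i s IH]; first by rewrite !big_nil poweR1r.
by rewrite !big_cons poweRM ?IH// prode_ge0.
Qed.

Lemma lee_prod (I : Type) (s : seq I) (F G : I -> \bar R) :
  (forall i, 0 <= F i) -> (forall i, F i <= G i) ->
  \prod_(i <- s) F i <= \prod_(i <- s) G i.
Proof.
move=> F0 FG; elim: s => [|i s IH]; first by rewrite !big_nil.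
by rewrite !big_cons; apply: lee_pmul => //; exact: prode_ge0.
Qed.

Lemma emeasurable_prod d (T : measurableType d) (I : Type) (s : seq I)
    (F : I -> T -> \bar R) : (forall i, measurable_fun setT (F i)) ->
  measurable_fun setT (fun x => \prod_(i <- s) F i x).
Proof.
move=> mF; elim: s => [|i s IH].
  by under eq_fun do rewrite big_nil; exact: measurable_cst.
by under eq_fun do rewrite big_cons; exact: emeasurable_funM.
Qed.

Lemma measurable_fun_poweR d (T : measurableType d) (f : T -> \bar R) (r : R) :
  measurable_fun setT f -> measurable_fun setT (fun x => f x `^ r).
Proof. by move=> mf; exact: (measurableT_comp (measurable_poweR r)). Qed.

End ereal_products.

Section hoelder_family.
Context d (T : measurableType d) (R : realType).
Variable mu : {measure set T -> \bar R}.

(** The integral of a nonnegative function is a supremum over the simple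
    functions below it; hence monotonicity, with f and g arbitrary. The
    integrand on the group, a composition of Lebesgue measurable functions
    with the projections, can thus be bounded before anything is known about
    its measurability. *)
Lemma le_ge0_integral (f g : T -> \bar R) :
  (forall x, 0 <= f x) -> (forall x, f x <= g x) ->
  \int[mu]_x f x <= \int[mu]_x g x.
Proof.
move=> f0 fg; have g0 x : 0 <= g x by exact: le_trans (f0 x) (fg x).
rewrite !ge0_integralTE//; apply: ge_ereal_sup => _ [h /= hf <-].
by apply: ereal_sup_ubound; exists h => // x; exact: le_trans (hf x) (fg x).
Qed.

(** Integrals equal to 0 or +oo are handled apart: if one is 0 then the
    product vanishes almost everywhere, and if one is +oo while neither is 0
    then the right-hand side is +oo. Otherwise Young's inequality is integrated,
    after normalising u and v to have integral 1. *)
Lemma ge0_hoelder (a b : R) (u v : T -> \bar R) : (0 < a)%R -> (0 < b)%R ->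
  (a + b = 1)%R -> (forall x, 0 <= u x) -> (forall x, 0 <= v x) ->
  measurable_fun setT u -> measurable_fun setT v ->
  \int[mu]_x (u x `^ a * v x `^ b) <=
  (\int[mu]_x u x) `^ a * (\int[mu]_x v x) `^ b.
Proof.
move=> a0 b0 ab u0 v0 mu_ mv.
have I0 w : (forall x, 0 <= w x) -> 0 <= \int[mu]_x w x.
  by move=> w0; exact: integral_ge0.
have degenerate (c e : R) w z : (0 < c)%R -> (forall x, 0 <= w x) ->
    measurable_fun setT w -> measurable_fun setT z -> \int[mu]_x w x = 0 ->
    \int[mu]_x (w x `^ c * z x `^ e) = 0.
  move=> c0 w0 mw mz iw0.
  have /ae_eq_integral_abs : \int[mu]_x `|w x| = 0.
    by rewrite -[RHS]iw0; apply: eq_integral => x _; rewrite gee0_abs.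
  move=> /(_ measurableT mw) wae.
  rewrite (ae_eq_integral (cst 0)) ?integral0//.
    by apply: emeasurable_funM; exact: measurable_fun_poweR.
  apply: filterS wae => x /(_ I) /= -> _.
  by rewrite poweR0r ?mul0e// gt_eqF.
have [iu0|iu0] := eqVneq (\int[mu]_x u x) 0.
  by rewrite degenerate// mule_ge0// poweR_ge0.
have [iv0|iv0] := eqVneq (\int[mu]_x v x) 0.
  under eq_integral do rewrite muleC.
  by rewrite degenerate// mule_ge0// poweR_ge0.
have pu : 0 < \int[mu]_x u x by rewrite lt0e iu0 I0.
have pv : 0 < \int[mu]_x v x by rewrite lt0e iv0 I0.
have [->|iuy] := eqVneq (\int[mu]_x u x) +oo.
  by rewrite poweRyr ?gt_eqF// gt0_mulye ?leey// poweR_gt0.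
have [->|ivy] := eqVneq (\int[mu]_x v x) +oo.
  by rewrite poweRyr ?gt_eqF// gt0_muley ?leey// poweR_gt0.
have fu : \int[mu]_x u x \is a fin_num by rewrite ge0_fin_numE ?I0// ltey.
have fv : \int[mu]_x v x \is a fin_num by rewrite ge0_fin_numE ?I0// ltey.
move: pu pv; rewrite -(fineK fu) -(fineK fv).
set U := fine _; set V := fine _; rewrite !lte_fin => pu pv.
pose C : R := (U `^ a * V `^ b)%R.
have C0 : (0 <= C)%R by rewrite mulr_ge0 ?powR_ge0.
have aU0 : (0 <= a / U)%R by rewrite divr_ge0 ?ltW.
have bV0 : (0 <= b / V)%R by rewrite divr_ge0 ?ltW.
rewrite 2!poweR_EFin -EFinM -/C.
apply: (@le_trans _ _
    (\int[mu]_x (C%:E * ((a / U)%:E * u x + (b / V)%:E * v x)))).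
  apply: le_ge0_integral => x; first by rewrite mule_ge0 ?poweR_ge0.
  have -> : u x `^ a * v x `^ b =
      C%:E * ((U^-1%:E * u x) `^ a * (V^-1%:E * v x) `^ b).
    rewrite !poweRM ?u0 ?v0 ?lee_fin ?invr_ge0 ?ltW// muleACA.
    rewrite [RHS]muleA 2!poweR_EFin -!EFinM mulrACA -!powRM ?invr_ge0 ?ltW//.
    by rewrite !mulfV ?gt_eqF// !powR1 mulr1 mul1e.
  apply: lee_wpmul2l; first by rewrite lee_fin.
  rewrite !EFinM -!muleA.
  by apply: poweR_young => //; rewrite mule_ge0 ?u0 ?v0 ?lee_fin ?invr_ge0 ?ltW.
rewrite ge0_integralZl ?lee_fin//; first last.
- by move=> x _; rewrite adde_ge0 ?mule_ge0 ?lee_fin.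
- by apply: emeasurable_funD; apply: emeasurable_funM.
rewrite ge0_integralD//; first last.
- by apply: emeasurable_funM.
- by move=> x _; rewrite mule_ge0 ?lee_fin.
- by apply: emeasurable_funM.
- by move=> x _; rewrite mule_ge0 ?lee_fin.
rewrite !ge0_integralZl ?lee_fin// -(fineK fu) -(fineK fv) -/U -/V.
rewrite -!EFinM lee_fin.
by rewrite -!mulrA !mulVf ?gt_eqF// !mulr1 ab mulr1.
Qed.

(** The splitting used in both inductions below: the exponents are
    1 / (r + 2) for u and (r + 1) / (r + 2) for the product, and the second one
    turns powers 1 / (r + 1) into powers 1 / (r + 2). *)
Lemma ge0_hoelder_step (r : nat) (I : Type) (s : seq I) (u : T -> \bar R)
    (h : I -> T -> \bar R) :
  (forall x, 0 <= u x) -> measurable_fun setT u ->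
  (forall i x, 0 <= h i x) -> (forall i, measurable_fun setT (h i)) ->
  \int[mu]_x (u x `^ r.+2%:R^-1 * \prod_(i <- s) h i x `^ r.+2%:R^-1) <=
  (\int[mu]_x u x) `^ r.+2%:R^-1 *
  (\int[mu]_x \prod_(i <- s) h i x `^ r.+1%:R^-1) `^ (r.+1%:R / r.+2%:R).
Proof.
move=> u0 mu_ h0 mh; set b : R := (r.+1%:R / r.+2%:R)%R.
have b0 : (0 < b)%R by rewrite divr_gt0.
have hb i x : h i x `^ r.+2%:R^-1 = (h i x `^ r.+1%:R^-1) `^ b.
  by rewrite -poweRrM mulrA mulVf// mul1r.
under eq_integral => x _.
  under eq_bigr do rewrite hb.
  rewrite -poweR_prod; last by move=> i; exact: poweR_ge0.
  over.
apply: ge0_hoelder => //.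
- by rewrite -[X in (X + _)%R]mul1r -mulrDl nat1r mulfV.
- by move=> x; apply: prode_ge0 => i _; exact: poweR_ge0.
- by apply: emeasurable_prod => i; exact: measurable_fun_poweR.
Qed.

Lemma ge0_hoelder_family (r : nat) (h : 'I_r.+1 -> T -> \bar R) :
  (forall k x, 0 <= h k x) -> (forall k, measurable_fun setT (h k)) ->
  \int[mu]_x \prod_(k < r.+1) h k x `^ r.+1%:R^-1 <=
  \prod_(k < r.+1) (\int[mu]_x h k x) `^ r.+1%:R^-1.
Proof.
elim: r h => [|r IH] h h0 mh.
  rewrite big_ord1; under eq_integral do rewrite big_ord1.
  rewrite invr1 poweRe1; last exact: integral_ge0.
  by under eq_integral do rewrite poweRe1//.
rewrite big_ord_recl; under eq_integral do rewrite big_ord_recl.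
apply: le_trans (ge0_hoelder_step _ _ _ _ _ _) _ => //.
apply: lee_wpmul2l; first exact: poweR_ge0.
set J := \int[mu]_x _.
have J0 : 0 <= J.
  by apply: integral_ge0 => x _; apply: prode_ge0 => i _; exact: poweR_ge0.
have b0 : (0 <= r.+1%:R / r.+2%:R :> R)%R by rewrite divr_ge0.
have := gt0_ler_poweR b0 _ _ (IH (fun k => h (lift ord0 k)) _ _).
rewrite -/J !in_itv /= !leey !andbT => /(_ J0) JIH.
apply: le_trans (JIH _ _ _) _ => //.
  by apply: prode_ge0 => i _; exact: poweR_ge0.
rewrite poweR_prod; last by move=> i; exact: poweR_ge0.
rewrite le_eqVlt; apply/orP; left; apply/eqP; apply: eq_bigr => i _.
by rewrite -poweRrM mulrA mulVf// mul1r.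
Qed.

End hoelder_family.

(** * Measurable majorants for the completion of a measure *)

Section completion.
Context d (T : measurableType d) (R : realType).
Variable mu : {measure set T -> \bar R}.
Local Notation cT := (caratheodory_type (mu^*)%mu).
Local Notation cmu := (@completed_measure_extension _ _ _ mu).

(** Intersect countable covers of A of total mass at most mu^*(A) + 1/(n+1);
    if A has infinite outer measure, the whole space will do. *)
Lemma measurable_hull (A : set T) :
  exists B, [/\ measurable B, A `<=` B & mu B <= (mu^*)%mu A].
Proof.
have [->|Afin] := eqVneq ((mu^*)%mu A) +oo.
  by exists setT; split => //; exact: leey.
have {}Afin : (mu^*)%mu A \is a fin_num.
  by rewrite ge0_fin_numE ?ltey// mu_ext_ge0.
have cover n : exists F : (set T)^nat, measurable_cover A F /\
    \sum_(k <oo) mu (F k) <= (mu^*)%mu A + (n.+1%:R^-1)%:E.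
  have e0 : (0 < n.+1%:R^-1 :> R)%R by rewrite invr_gt0.
  have [_ [F AF <-] /ltW Fe] := lb_ereal_inf_adherent e0 Afin.
  by exists F.
have {cover}[F FP] := choice cover.
have mF n : measurable (\bigcup_k F n k).
  by apply: bigcupT_measurable => k; have [[]] := FP n.
exists (\bigcap_n \bigcup_k F n k); split.
- exact: bigcapT_measurable.
- by move=> x Ax n _; have [[_ AF] _] := FP n; exact: AF.
- apply/lee_addgt0Pr => e /ltr_add_invr[n]; rewrite add0r => /ltW ne.
  have [[mFn _] Fe] := FP n.
  apply: (@le_trans _ _ ((mu^*)%mu A + (n.+1%:R^-1)%:E)); last first.
    by rewrite leeD2l// lee_fin.
  apply: le_trans Fe; apply: measure_sigma_subadditive => //.
    exact: bigcapT_measurable.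
  by move=> x; apply.
Qed.

Lemma limn_einf_le (u v : (\bar R)^nat) :
  (forall n, u n <= v n) -> limn_einf u <= limn_einf v.
Proof.
move=> uv; rewrite !limn_einf_lim.
apply: lee_lim; [exact: is_cvg_einfs|exact: is_cvg_einfs|].
apply: nearW => n.
apply: le_ereal_inf_tmp => _ [k nk <-].
by apply: (le_trans _ (uv k)); apply: ereal_inf_lbound; exists k.
Qed.

Import HBNNSimple.

(** Replace each level set of f by a measurable hull. The hulls of disjoint
    sets may overlap, so that the sum over the values of f majorizes f. *)
Lemma nnsfun_hull (f : {nnsfun cT >-> R}) : exists h : T -> \bar R,
  [/\ measurable_fun setT h, forall x, (f x)%:E <= h x &
      \int[mu]_x h x <= \int[cmu]_x (f x)%:E].
Proof.
have [B Bhull] := choice (fun y : R => measurable_hull (f @^-1` [set y])).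
have mB y : measurable (B y) by have [] := Bhull y.
(* `|y| makes the summand nonnegative for every real y; only the values of f,
   which are nonnegative, contribute to the sum. *)
pose s (y : R) (x : T) : \bar R := `|y|%:E * (\1_(B y) x)%:E.
have ms y : measurable_fun setT (s y).
  by apply: emeasurable_funM => //; exact/measurable_EFinP/measurable_indic.
have s0 y x : 0 <= s y x by rewrite mule_ge0 ?lee_fin.
exists (fun x => \sum_(y \in range f) s y x); split.
- exact: emeasurable_fsum.
- move=> x; rewrite fimfunE -fsumEFin//; apply: lee_fsum => // y _.
  have [_ /(_ x) fB _] := Bhull y.
  rewrite EFinM; apply: le_trans (_ : `|y|%:E * _ <= _).
    by apply: lee_wpmul2r; rewrite lee_fin ?ler_norm.
  apply: lee_wpmul2l; rewrite lee_fin// !indicE.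
  by have [/set_mem/fB/mem_set ->|] := boolP (_ \in f @^-1` _).
- rewrite ge0_integral_fsum// integralT_nnsfun sintegralE.
  apply: lee_fsum => // _ [x _ <-].
  have fx0 : (0 <= f x)%R by [].
  rewrite ge0_integralZl ?lee_fin//; last first.
  + exact/measurable_EFinP/measurable_indic.
  rewrite integral_indic// setIT ger0_norm//.
  by apply: lee_wpmul2l; rewrite ?lee_fin//; have [] := Bhull (f x).
Qed.

(** The lower limit of majorants of simple functions increasing to f majorizes
    f, and Fatou's lemma controls its integral. *)
Lemma measurable_majorant (f : cT -> \bar R) : measurable_fun setT f ->
  (forall x, 0 <= f x) -> exists h : T -> \bar R,
  [/\ measurable_fun setT h, forall x, f x <= h x &
      \int[mu]_x h x <= \int[cmu]_x f x].
Proof.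
move=> mf f0; pose g := nnsfun_approx measurableT mf.
have [h hP] := choice (fun n => nnsfun_hull (g n)).
have gf n x : (g n x)%:E <= f x.
  by rewrite nnsfun_approxE; exact: le_approx.
have mh n : measurable_fun setT (h n) by have [] := hP n.
have h0 n x : 0 <= h n x.
  by have [_ /(_ x) + _] := hP n; apply: le_trans; rewrite lee_fin.
exists (fun x => limn_einf (h ^~ x)); split.
- rewrite /limn_einf; apply: measurableT_comp => //.
  by apply: measurable_fun_limn_esup => n; exact: measurableT_comp.
- move=> x.
  have [<- _] := cvg_limn_einf_sup
    (cvg_nnsfun_approx measurableT mf (fun x _ => f0 x) (I : setT x)).
  by apply: limn_einf_le => n; have [_ gh _] := hP n; exact: gh.
- apply: (@le_trans _ _ (limn_einf (fun n => \int[mu]_x h n x))).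
    by apply: fatou.
  have [<- _] := @cvg_limn_einf_sup R (fun=> \int[cmu]_x f x) _ (cvg_cst _).
  apply: limn_einf_le => n; have [_ _ hg] := hP n; apply: le_trans hg _.
  by apply: le_ge0_integral => x; rewrite ?lee_fin.
Qed.

Lemma measurable_id_completion : measurable_fun setT (id : cT -> T).
Proof.
move=> _ A mA; rewrite setTI preimage_id.
exact: caratheodory_measurable_mu_ext.
Qed.

Lemma integral_completion (h : T -> \bar R) : measurable_fun setT h ->
  (forall x, 0 <= h x) -> \int[cmu]_x h x = \int[mu]_x h x.
Proof.
move=> mh h0.
have := ge0_integral_pushforward measurable_id_completion cmu measurableT mh
  (fun x _ => h0 x).
rewrite preimage_setT => <-.
apply: eq_measure_integral => [|mid A mA _].
  exact: measurable_id_completion.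
exact: measurable_mu_extE.
Qed.

End completion.

(** * Coordinate deletion and Lebesgue measure on tuples *)

Section tuple_projections.
Context {R : realType}.
Local Notation T := (measurableTypeR R).
Local Notation leb := (@lebesgue_measure R).

Definition tuple_del m (k : nat) (x : m.+1.-tuple T) : m.-tuple T :=
  [tuple (x : seq R)`_(bump k i) | i < m].

Lemma tuple_del_last m (p : m.-tuple T * T) : tuple_del m (tuple_rcons p) = p.1.
Proof.
apply: eq_from_tnth => i; rewrite tnth_mktuple /= nth_rcons size_tuple.
rewrite (_ : bump m i = i) ?ltn_ord ?(tnth_nth 0%R)//.
by rewrite /bump [(m <= i)%N]leqNgt ltn_ord.
Qed.

(** Deletion of a coordinate other than the last one commutes with appending
    the last one; this makes the projections of R^(m+2) = R^(m+1) x R restrict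
    to those of R^(m+1). *)
Lemma tuple_del_rcons m k (x : m.+1.-tuple T) (t : T) : (k <= m)%N ->
  tuple_del k (tuple_rcons (x, t)) = tuple_rcons (tuple_del k x, t).
Proof.
move=> km; apply: eq_from_tnth => i; rewrite tnth_tuple_rcons tnth_mktuple /=.
rewrite nth_rcons size_tuple; case: (ltnP i m) => im.
  rewrite (nth_mktuple_lt (R := R) _ im) /=.
  rewrite (_ : (bump k i < m.+1)%N)//.
  by rewrite ltnS /bump; case: (k <= i)%N; rewrite ?add1n ?add0n// ltnW.
have -> : nat_of_ord i = m by apply/eqP; rewrite eqn_leq im -ltnS ltn_ord.
by rewrite /bump km add1n ltnn eqxx.
Qed.

Lemma measurable_nth m (k : nat) :
  measurable_fun setT (fun x : m.-tuple T => (x : seq R)`_k : T).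
Proof.
have [km|mk] := ltnP k m; last first.
  rewrite (_ : (fun x => _) = cst 0%R)//.
  by apply/funext => x; rewrite nth_default// size_tuple.
rewrite (_ : (fun x => _) = (fun x : m.-tuple T => tnth x (Ordinal km))).
  exact: measurable_tnth.
by apply/funext => x; rewrite (tnth_nth 0%R).
Qed.

Lemma measurable_tuple_del m k : measurable_fun setT (@tuple_del m k).
Proof.
apply/measurable_fun_tnthP => i.
rewrite (_ : _ \o _ = (fun x : m.+1.-tuple T => (x : seq R)`_(bump k i) : T)).
  exact: measurable_nth.
by apply/funext => x; rewrite /= tnth_mktuple.
Qed.

Lemma integral_tuple0 (f : 0.-tuple T -> \bar R) :
  measurable_fun setT f -> \int[@lebesgue_tuple R 0]_x f x = f [tuple].
Proof.
move=> mf; rewrite [LHS](@integral_dirac _ _ [tuple] R setT measurableT f mf).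
by rewrite diracE mem_set// mul1e.
Qed.

Lemma integral_tupleS m (f : m.+1.-tuple T -> \bar R) :
  measurable_fun setT f -> (forall x, 0 <= f x) ->
  \int[@lebesgue_tuple R m.+1]_x f x =
  \int[@lebesgue_tuple R m \x leb]_p f (tuple_rcons p).
Proof.
move=> mf f0.
have := ge0_integral_pushforward (@measurable_tuple_rcons R m)
  (@lebesgue_tuple R m \x leb) measurableT mf (fun x _ => f0 x).
by rewrite preimage_setT => <-.
Qed.

Lemma integral_shift (c : R) (f : T -> \bar R) :
  measurable_fun setT f -> (forall x, 0 <= f x) ->
  \int[leb]_t f (t + c)%R = \int[leb]_t f t.
Proof.
move=> mf f0.
have mc : measurable_fun setT (fun t : T => (t + c)%R : T).
  exact: measurable_funD.
have := ge0_integral_pushforward mc leb measurableT mf (fun x _ => f0 x).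
rewrite preimage_setT => <-.
apply: eq_measure_integral => A mA _.
apply/esym/lebesgue_measure_unique => // _ [[a b]] _ <-.
rewrite /= /pushforward.
rewrite (_ : _ @^-1` _ = `](a - c)%R, (b - c)%R]%classic); last first.
  by apply/seteqP; split => t /=; rewrite !in_itv /= ltrBlDr lerBrDr.
by rewrite !lebesgue_measure_itv /= !lte_fin ltrD2r -!EFinD opprB addrA subrK.
Qed.

End tuple_projections.

(** * The Loomis-Whitney inequality for sheared projections *)

Section sheared_loomis_whitney.
Context {R : realType}.
Local Notation T := (measurableTypeR R).
Local Notation leb := (@lebesgue_measure R).
Local Notation Leb m := (@lebesgue_tuple R m).

Definition fiber_integral m (g : m.+1.-tuple T -> \bar R) (y : m.-tuple T) :=
  \int[leb]_t g (tuple_rcons (y, t)).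

Section fiber.
Variables (m : nat) (g : m.+1.-tuple T -> \bar R).
Hypotheses (mg : measurable_fun setT g) (g0 : forall x, 0 <= g x).

Let mgr : measurable_fun setT (fun p : m.-tuple T * T => g (tuple_rcons p)).
Proof. exact: measurableT_comp mg (@measurable_tuple_rcons R m). Qed.

Lemma fiber_integral_ge0 y : 0 <= fiber_integral g y.
Proof. exact: integral_ge0. Qed.

Lemma measurable_fiber_integral : measurable_fun setT (fiber_integral g).
Proof. exact: (measurable_fun_fubini_tonelli_F _ mgr). Qed.

Lemma integral_fiber_integral :
  \int[Leb m]_y fiber_integral g y = \int[Leb m.+1]_x g x.
Proof. by rewrite integral_tupleS// (fubini_tonelli1 _ mgr). Qed.

End fiber.

(** For k >= m this is the vertical projection (x, t) |-> x: the m + 1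
    projections are those with k <= m. *)
Definition shear_proj m (s : nat -> m.-tuple T -> T) (k : nat)
    (p : m.-tuple T * T) : m.-tuple T :=
  if (k < m)%N then tuple_del k (tuple_rcons (p.1, p.2 + s k p.1)%R) else p.1.

Lemma measurable_shear_proj m (s : nat -> m.-tuple T -> T) k :
  measurable_fun setT (s k) -> measurable_fun setT (shear_proj s k).
Proof.
move=> ms; rewrite /shear_proj; case: (k < m)%N; last exact: measurable_fst.
apply: measurableT_comp; first exact: measurable_tuple_del.
apply: measurableT_comp; first exact: measurable_tuple_rcons.
apply/measurable_fun_pairP; split => /=; first exact: measurable_fst.
apply: measurable_funD; first exact: measurable_snd.
exact: measurableT_comp.
Qed.

Section integrate_last.
Variables (m : nat) (s : nat -> m.+1.-tuple T -> T).
Variable g : 'I_m.+2 -> m.+1.-tuple T -> \bar R.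
Hypothesis ms : forall k, measurable_fun setT (s k).
Hypothesis mg : forall k, measurable_fun setT (g k).
Hypothesis g0 : forall k x, 0 <= g k x.

Let r : R := m.+1%:R^-1.
Let G (k : 'I_m.+1) := fiber_integral (g (widen_ord (leqnSn _) k)).

(** For fixed x, Hoelder's inequality in t for m + 1 functions with equal
    exponents; translation invariance then removes the shears. *)
Lemma le_integrate_last :
  \int[Leb m.+1 \x leb]_p \prod_(k < m.+2) g k (shear_proj s k p) `^ r <=
  \int[Leb m.+1]_x
    (g ord_max x `^ r * \prod_(k < m.+1) G k (tuple_del k x) `^ r).
Proof.
rewrite (fubini_tonelli1
  (fun p => \prod_(k < m.+2) g k (shear_proj s k p) `^ r)); first last.
- by move=> p; apply: prode_ge0 => i _; exact: poweR_ge0.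
- apply: emeasurable_prod => k; apply: measurable_fun_poweR.
  by apply: measurableT_comp => //; exact: measurable_shear_proj.
apply: le_ge0_integral => x.
  by apply: integral_ge0 => t _; apply: prode_ge0 => i _; exact: poweR_ge0.
rewrite /fubini_F.
pose w (k : 'I_m.+1) (t : T) :=
  g (widen_ord (leqnSn _) k) (tuple_rcons (tuple_del k x, t)).
have mw k : measurable_fun setT (w k).
  apply: measurableT_comp => //; apply: measurableT_comp.
    exact: measurable_tuple_rcons.
  exact: measurable_fun_pair.
pose ws (k : 'I_m.+1) (t : T) := w k (t + s k x)%R.
have mws k : measurable_fun setT (ws k).
  have mc : measurable_fun setT (fun t : T => (t + s k x)%R : T).
    exact: measurable_funD.
  exact: measurableT_comp (mw k) mc.
rewrite (eq_integral
  (fun t => g ord_max x `^ r * \prod_(k < m.+1) ws k t `^ r)); last first.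
  move=> t _; rewrite big_ord_recr /= {2}/shear_proj ltnn muleC; congr (_ * _).
  apply: eq_bigr => k _.
  have km : (k <= m)%N := ltn_ord k.
  by rewrite /shear_proj /= ltn_ord tuple_del_rcons.
rewrite ge0_integralZl ?poweR_ge0//; first last.
- by move=> t _; apply: prode_ge0 => i _; exact: poweR_ge0.
- by apply: emeasurable_prod => k; apply: measurable_fun_poweR; exact: mws.
apply: lee_wpmul2l; first exact: poweR_ge0.
apply: (le_trans (ge0_hoelder_family _ _ mws)); first by move=> k t; exact: g0.
apply: lee_prod => k; first exact: poweR_ge0.
by rewrite /ws integral_shift// => t; exact: g0.
Qed.

End integrate_last.

(** The shears are arbitrary, but the induction hypothesis is used only for
    the zero shear: after the integration in t the remaining functions are
    evaluated at the coordinate deletions of x. For m = 0 a function on R^0 is a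
    constant, and Tonelli's theorem suffices. *)
Theorem sheared_loomis_whitney_succ m (s : nat -> m.+1.-tuple T -> T)
    (g : 'I_m.+2 -> m.+1.-tuple T -> \bar R) :
  (forall k, measurable_fun setT (s k)) ->
  (forall k, measurable_fun setT (g k)) -> (forall k x, 0 <= g k x) ->
  \int[Leb m.+1 \x leb]_p
     \prod_(k < m.+2) g k (shear_proj s k p) `^ m.+1%:R^-1 <=
  \prod_(k < m.+2) (\int[Leb m.+1]_x g k x) `^ m.+1%:R^-1.
Proof.
elim: m s g => [|m IH] s g ms mg g0.
  apply: le_trans (le_integrate_last ms mg g0) _.
  rewrite big_ord_recr big_ord1 /= invr1 muleC.
  rewrite !poweRe1 ?integral_ge0//.
  rewrite -(integral_fiber_integral (mg (widen_ord _ ord0)) (g0 _)).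
  set G := fiber_integral _.
  have mG : measurable_fun setT G.
    exact: (measurable_fiber_integral (mg _) (g0 _)).
  have G0 : forall y, 0 <= G y by exact: (fiber_integral_ge0 (g0 _)).
  rewrite integral_tuple0// -(ge0_integralZr _ measurableT (mg _))//.
  apply: le_ge0_integral => x; rewrite big_ord1 !poweRe1// ?mule_ge0//.
  by rewrite (tuple0 (tuple_del _ _)).
apply: le_trans (le_integrate_last ms mg g0) _.
pose G (k : 'I_m.+2) := fiber_integral (g (widen_ord (leqnSn _) k)).
have mG k : measurable_fun setT (G k).
  exact: (measurable_fiber_integral (mg _) (g0 _)).
have G0 k y : 0 <= G k y by exact: (fiber_integral_ge0 (g0 _)).
apply: (le_trans (@ge0_hoelder_step _ _ _ (Leb m.+2) m _ (index_enum 'I_m.+2)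
  (g ord_max) (fun k x => G k (tuple_del k x)) _ _ _ _)) => //.
  by move=> k; apply: measurableT_comp => //; exact: measurable_tuple_del.
rewrite big_ord_recr muleC; apply: lee_wpmul2r; first exact: poweR_ge0.
set J := \int[_]_x _.
have J0 : 0 <= J.
  by apply: integral_ge0 => x _; apply: prode_ge0 => i _; exact: poweR_ge0.
have J_le : J <= \prod_(k < m.+2) (\int[Leb m.+1]_y G k y) `^ m.+1%:R^-1.
  rewrite /J integral_tupleS; first last.
  - by move=> x; apply: prode_ge0 => i _; exact: poweR_ge0.
  - apply: emeasurable_prod => k; apply: measurable_fun_poweR.
    by apply: measurableT_comp => //; exact: measurable_tuple_del.
  apply: le_trans (IH (fun _ => cst 0%R) G _ mG G0); last first.
    by move=> k; exact: measurable_cst.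
  apply: le_ge0_integral => p.
    by apply: prode_ge0 => i _; exact: poweR_ge0.
  apply: lee_prod => k; first exact: poweR_ge0.
  rewrite /shear_proj /= addr0 -surjective_pairing; case: ltnP => // mk.
  have -> : nat_of_ord k = m.+1 by apply/eqP; rewrite eqn_leq mk -ltnS ltn_ord.
  by rewrite tuple_del_last.
have b0 : (0 <= m.+1%:R / m.+2%:R :> R)%R by rewrite divr_ge0.
have := gt0_ler_poweR b0 _ _ J_le.
rewrite !in_itv /= !leey !andbT => /(_ J0) JIH.
apply: le_trans (JIH _) _.
  by apply: prode_ge0 => i _; exact: poweR_ge0.
rewrite poweR_prod; last by move=> i; exact: poweR_ge0.
rewrite le_eqVlt; apply/orP; left; apply/eqP; apply: eq_bigr => k _.
by rewrite -poweRrM mulrA mulVf// mul1r integral_fiber_integral.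
Qed.

Corollary sheared_loomis_whitney m (s : nat -> m.-tuple T -> T)
    (g : 'I_m.+1 -> m.-tuple T -> \bar R) : (0 < m)%N ->
  (forall k, measurable_fun setT (s k)) ->
  (forall k, measurable_fun setT (g k)) -> (forall k x, 0 <= g k x) ->
  \int[Leb m \x leb]_p \prod_(k < m.+1) g k (shear_proj s k p) `^ m%:R^-1 <=
  \prod_(k < m.+1) (\int[Leb m]_x g k x) `^ m%:R^-1.
Proof. by case: m s g => // m s g _; exact: sheared_loomis_whitney_succ. Qed.

End sheared_loomis_whitney.

(** * The group projections as sheared projections *)

Section carnot_shear.
Context {R : realType} {d n : nat} (alpha : n.-tuple R).
Local Notation T := (measurableTypeR R).
Local Notation m := (d + 2 * n)%N.

Definition carnot_shear (k : nat) (x : m.-tuple T) : T :=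
  let j := ((k - d) %/ 2)%N in
  let q := (alpha`_j / 2 * (x : seq R)`_(d + 2 * j) *
            (x : seq R)`_(d + 2 * j + 1))%R in
  if (k < d)%N then 0%R else if odd (k - d) then (- q)%R else q.

Lemma measurable_carnot_shear k : measurable_fun setT (carnot_shear k).
Proof.
rewrite /carnot_shear; case: (k < d)%N; first exact: measurable_cst.
have mq : measurable_fun setT (fun x : m.-tuple T =>
    alpha`_((k - d) %/ 2) / 2 * (x : seq R)`_(d + 2 * ((k - d) %/ 2)) *
    (x : seq R)`_(d + 2 * ((k - d) %/ 2) + 1) : T)%R.
  apply: measurable_funM; last exact: measurable_nth.
  by apply: measurable_funM => //; exact: measurable_nth.
by case: odd => //; exact: measurableT_comp.
Qed.

Lemma carnot_projE (k : 'I_m.+1) (p : carnot d alpha) :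
  carnot_proj k p = shear_proj carnot_shear k p.
Proof.
case: p => x t; rewrite /carnot_proj /shear_proj /carnot_shear /=.
have [kd|_] := ltnP k d; first by rewrite ltn_addr// addr0.
by case: (ltnP k m) => // _; case: odd.
Qed.

End carnot_shear.

Theorem proposition1 (R : realType) (d n : nat) (hn : (1 <= n)%N)
    (alpha : n.-tuple R)
    (alpha_gt0 : forall i : 'I_n, (0 < tnth alpha i)%R)
    (alpha_le : forall i j : 'I_n, (i <= j)%N ->
       (tnth alpha i <= tnth alpha j)%R)
    (f : 'I_(d + 2 * n).+1 -> euclidean R (d + 2 * n) -> \bar R)
    (f_ge0 : forall k x, 0 <= f k x)
    (f_meas : forall k, measurable_fun setT (f k)) :
  \int[carnot_Lebesgue d alpha]_p
     \prod_(k < (d + 2 * n).+1) f k (carnot_proj k p)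
  <= \prod_(k < (d + 2 * n).+1)
       'N[Lebesgue]_((d + 2 * n)%:R%:E) [f k].
Proof.
set m := (d + 2 * n)%N.
have m0 : (0 < m)%N by rewrite addn_gt0 muln_gt0 hn orbT.
have mR0 : (m%:R != 0 :> R)%R by rewrite pnatr_eq0 -lt0n.
have fm_meas k : measurable_fun setT (fun x => f k x `^ m%:R).
  exact: measurable_fun_poweR.
(* The power f k ^ m is majorized rather than f k, as it is the integral of
   this power that must not increase. *)
have [h hP] := choice (fun k =>
  measurable_majorant (fm_meas k) (fun x => poweR_ge0 (f k x) m%:R)).
have mh k : measurable_fun setT (h k) by have [] := hP k.
have f_le k x : f k x `^ m%:R <= h k x by have [_ fh _] := hP k; exact: fh.
have h0 k x : 0 <= h k x by apply: le_trans (f_le k x); exact: poweR_ge0.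
have mono (x y : \bar R) : 0 <= x -> x <= y -> x `^ m%:R^-1 <= y `^ m%:R^-1.
  move=> x0 xy; apply: gt0_ler_poweR => //.
    by rewrite in_itv /= x0 leey.
  by rewrite in_itv /= (le_trans x0 xy) leey.
have f_root k x : f k x = (f k x `^ m%:R) `^ m%:R^-1.
  by rewrite -poweRrM mulfV// poweRe1.
pose s := carnot_shear (d := d) alpha.
pose H p := \prod_(k < m.+1) h k (shear_proj s k p) `^ m%:R^-1.
have mH : measurable_fun setT H.
  apply: emeasurable_prod => k; apply: measurable_fun_poweR.
  apply: measurableT_comp => //; apply: measurable_shear_proj.
  exact: measurable_carnot_shear.
have H0 p : 0 <= H p by apply: prode_ge0 => k _; exact: poweR_ge0.
apply: (@le_trans _ _ (\int[carnot_Lebesgue d alpha]_p H p)).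
  apply: le_ge0_integral => p; first exact: prode_ge0.
  apply: lee_prod => // k; rewrite carnot_projE.
  rewrite [leLHS]f_root.
  by apply: mono => //; exact: poweR_ge0.
have -> : \int[carnot_Lebesgue d alpha]_p H p =
    \int[@lebesgue_tuple R m \x @lebesgue_measure R]_p H p.
  exact: integral_completion.
apply: le_trans (sheared_loomis_whitney m0 _ mh h0) _.
  by move=> k; exact: measurable_carnot_shear.
apply: lee_prod => k; first exact: poweR_ge0.
rewrite unlock; apply: mono; first exact: integral_ge0.
have [_ _ hf] := hP k; apply: le_trans hf _.
by apply: le_ge0_integral => x; rewrite ?poweR_ge0// gee0_abs.
Qed.
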